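(* Let $n\ge 2$. The affine variety $V={\rm Sec}((\mathbb{P}^1)^{\times n})\cap\{x_\emptyset\neq 0\}$ is (isomorphic to) the trivial affine bundle of rank $n$ over the affine toric variety $T_{2,n}$, that is, $V\cong T_{2,n}\times\mathbb{A}^n$. In particular the secant variety ${\rm Sec}((\mathbb{P}^1)^{\times n})$ is locally isomorphic to the trivial affine bundle of rank $n$ over $T_{2,n}$ (it is covered by open subsets isomorphic to $T_{2,n}\times\mathbb{A}^n$).
   Context: The ground field is $\mathbb{C}$. Let $x_I$, $I\subseteq[n]=\{1,\dots,n\}$, be homogeneous coordinates on $\mathbb{P}^{2^n-1}$. The Segre embedding $(\mathbb{P}^1)^{\times n}\to\mathbb{P}^{2^n-1}$ is $([a_1^1,a_1^2],\dots,[a_n^1,a_n^2])\mapsto[x_I=\prod_{i\in I}a_i^1\prod_{i\notin I}a_i^2]$. ${\rm Sec}((\mathbb{P}^1)^{\times n})$ is the Zariski closure of the union of all lines joining pairs of distinct points of its image. The variety $T_{2,n}$ is the Zariski closure in the affine space with coordinates $z_I$ ($I\subseteq[n]$, $2\le|I|\le n$) of the image of the map $(\mathbb{C}^* )^{n+1}\ni(t_0,t_1,\dots,t_n)\mapsto\big(z_I=t_0\prod_{i\in I}t_i\big)$. *)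

(* Defs.v *)
From HB Require Import structures.
From mathcomp Require Import all_boot all_order all_algebra.
From mathcomp Require Import classical_sets reals.
From mathcomp Require Import complex mpoly.

Set Implicit Arguments.
Unset Strict Implicit.
Unset Printing Implicit Defensive.

Import GRing.Theory.
Local Open Scope classical_set_scope.
Local Open Scope ring_scope.

(* An ambient space (affine or projective) is given by its points, its Zariski
   closed sets and, for every set U of points, the functions that are regular
   on U.  A (quasi-affine or quasi-projective) variety is a locally closed set
   of points, with the induced topology; functions and maps are total on the
   ambient space and only their values on the variety matter. *)
Record ambient (K : Type) := Ambient {
  point :> Type;
  zclosed : set point -> Prop;
  regular : set point -> (point -> K) -> Prop
}.

Section Varieties.
Variable K : Type.
Implicit Types S : ambient K.

Definition zopen S (O : set S) : Prop := zclosed (~` O).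

Definition zclosure S (X : set S) : set S := smallest (@zclosed K S) X.

Definition open_in S (X U : set S) : Prop := exists2 O, zopen O & U = X `&` O.

Definition regular_map S S' (X : set S) (Y : set S') (phi : S -> S') : Prop :=
  [/\ forall x, X x -> Y (phi x),
      forall O : set S', zopen O -> open_in X (X `&` phi @^-1` O)
    & forall (O : set S') (f : S' -> K), zopen O ->
        regular (Y `&` O) f -> regular (X `&` phi @^-1` O) (f \o phi)].

Definition isomorphic S S' (X : set S) (Y : set S') : Prop :=
  exists (phi : S -> S') (psi : S' -> S),
    [/\ regular_map X Y phi, regular_map Y X psi,
        forall x, X x -> psi (phi x) = x
      & forall y, Y y -> phi (psi y) = y].

End Varieties.

Section AffineSpace.
Variables (K : fieldType) (J : finType).

Definition coords := {ffun J -> K^o}.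

Definition peval (p : {mpoly K[#|J|]}) (x : coords) : K :=
  p.@[fun i => x (enum_val i)].

Definition affine_closed (Z : set coords) : Prop :=
  exists F : set {mpoly K[#|J|]},
    Z = [set x | forall p, F p -> peval p x = 0].

Definition affine_regular (U : set coords) (f : coords -> K) : Prop :=
  forall x, U x -> exists (W : set coords) (g h : {mpoly K[#|J|]}),
    [/\ affine_closed (~` W), W x
      & forall y, U y -> W y -> peval h y != 0 /\ f y = peval g y / peval h y].

Definition affine_space : ambient K := Ambient affine_closed affine_regular.

End AffineSpace.

Section ProjectiveSpace.
Variables (K : fieldType) (J : finType).

(* Points are the lines through the origin; the homogeneous coordinates of a
   point are the nonzero vectors of the line. *)
Definition proj := {L : {vspace coords K J} | \dim L == 1%N}.

Definition hcoords (P : proj) (v : coords K J) : bool :=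
  (v \in val P) && (v != 0).

Definition proj_closed (Z : set proj) : Prop :=
  exists2 F : set {mpoly K[#|J|]},
    forall p, F p -> exists d : nat, p \is d.-homog
    & Z = [set P | forall p, F p -> forall v, hcoords P v -> peval p v = 0].

Definition proj_regular (U : set proj) (f : proj -> K) : Prop :=
  forall P, U P ->
  exists (W : set proj) (d : nat) (g h : {mpoly K[#|J|]}),
    [/\ proj_closed (~` W), W P, g \is d.-homog, h \is d.-homog
      & forall Q v, U Q -> W Q -> hcoords Q v ->
          peval h v != 0 /\ f Q = peval g v / peval h v].

Definition proj_space : ambient K := Ambient proj_closed proj_regular.

Lemma dim_mkproj (v : coords K J) : v != 0 -> \dim <[v]>%VS == 1%N.
Proof. by move=> v0; rewrite dim_vline v0. Qed.

Definition mkproj (v : coords K J) (v0 : v != 0) : proj :=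
  exist _ <[v]>%VS (dim_mkproj v0).

Lemma hcoords_vpick (P : proj) : hcoords P (vpick (val P)).
Proof.
rewrite /hcoords memv_pick vpick0 -dimv_eq0.
by rewrite (eqP (valP P)).
Qed.

Definition pick_coords (P : proj) : coords K J := vpick (val P).

Lemma pick_coords_neq0 (P : proj) : pick_coords P != 0.
Proof. by case/andP: (hcoords_vpick P). Qed.

End ProjectiveSpace.

Section AffineProduct.
Variables (K : fieldType) (J L : finType).

Definition affine_prod (X : set (affine_space K J)) (Y : set (affine_space K L)) :
    set (affine_space K (J + L)%type) :=
  [set z | X [ffun j => z (inl j)] /\ Y [ffun l => z (inr l)]].

Definition affine_n (n : nat) : set (affine_space K 'I_n) := [set: coords K 'I_n].

End AffineProduct.

Section Secant.
Variables (K : fieldType) (n : nat).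

Local Notation P1 := (proj K 'I_2).

(* The coordinates a_i^1, a_i^2 of the i-th factor are a i 0, a i 1. *)
Definition segre_vec (a : 'I_n -> coords K 'I_2) : coords K {set 'I_n} :=
  [ffun I : {set 'I_n} => (\prod_(i in I) a i 0) * \prod_(i in ~: I) a i 1].

Lemma segre_vec_neq0 (a : 'I_n -> coords K 'I_2) :
  (forall i, a i != 0) -> segre_vec a != 0.
Proof.
move=> a0; apply/eqP => /ffunP /(_ [set i | a i 0 != 0]%SET); rewrite !ffunE.
apply/eqP; rewrite mulf_neq0 //; apply/prodf_neq0 => i; rewrite !inE ?negbK //.
move=> /eqP ai0; apply: contra (a0 i) => /eqP ai1.
apply/eqP/ffunP => -[[|[|//]] k]; rewrite ffunE.
- by rewrite -[RHS]ai0; congr (a i _); apply: val_inj.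
- by rewrite -[RHS]ai1; congr (a i _); apply: val_inj.
Qed.

Definition segre (a : 'I_n -> P1) : proj K {set 'I_n} :=
  mkproj (segre_vec_neq0 (fun i => pick_coords_neq0 (a i))).

(* The chosen coordinates are irrelevant. *)
Lemma segreE (a : 'I_n -> P1) (v : 'I_n -> coords K 'I_2) :
  (forall i, hcoords (a i) (v i)) -> hcoords (segre a) (segre_vec v).
Proof.
move=> av; rewrite /hcoords segre_vec_neq0 ?andbT; last first.
  by move=> i; case/andP: (av i).
have avE i : {c : K | v i = c *: pick_coords (a i)}.
  apply: sig_eqW; apply/vlineP.
  suff <- : val (a i) = <[pick_coords (a i)]>%VS by case/andP: (av i).
  apply/eqP; rewrite eq_sym eqEdim -memvE memv_pick.
  by rewrite (eqP (valP (a i))) (eqP (dim_mkproj (pick_coords_neq0 _))).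
apply/vlineP; exists (\prod_i sval (avE i)).
apply/ffunP => I; rewrite !ffunE /=.
have cE i k : v i k = sval (avE i) * pick_coords (a i) k.
  by rewrite [in LHS](svalP (avE i)) ffunE.
rewrite (eq_bigr _ (fun i _ => cE i 0)) [X in _ * X](eq_bigr _ (fun i _ => cE i 1)).
rewrite !big_split /= mulrACA; congr (_ * _).
rewrite [RHS](bigID (mem I)) /=; congr (_ * _).
by apply: eq_bigl => i; rewrite inE.
Qed.

Definition secant_lines : set (proj_space K {set 'I_n}) :=
  [set P | exists a b : 'I_n -> P1, segre a <> segre b /\
     (val P <= val (segre a) + val (segre b))%VS].

Definition Sec : set (proj_space K {set 'I_n}) := zclosure secant_lines.

Definition x_empty_neq0 : set (proj_space K {set 'I_n}) :=
  [set P | forall v, hcoords P v -> v finset.set0 != 0].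

Definition SecV : set (proj_space K {set 'I_n}) := Sec `&` x_empty_neq0.

Definition big_subset := {I : {set 'I_n} | (2 <= #|I|)%N}.

Definition monomial_point (t0 : K) (t : 'I_n -> K) : coords K big_subset :=
  [ffun I : big_subset => t0 * \prod_(i in val I) t i].

Definition T2 : set (affine_space K big_subset) :=
  zclosure (S := affine_space K big_subset) [set z | exists (t0 : K) (t : 'I_n -> K),
    [/\ t0 != 0, forall i, t i != 0 & z = monomial_point t0 t]].

End Secant.

Arguments Sec : clear implicits.
Arguments SecV : clear implicits.
Arguments T2 : clear implicits.
Arguments affine_n : clear implicits.

(* Main.v *)
(* Points of the secant variety with x_0 = 1 (0 the empty set) are, generically,
   mixtures x_I = p * prod_I a_i + (1 - p) * prod_I b_i.  Put y_i = x_{i},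
   d_i = a_i - b_i, q = p (1 - p), s = 1 - 2 p, and
   u_I = q s^(|I| - 2) prod_I d_i for |I| >= 2: this is the monomial point of
   T_{2,n} with t_0 = q / s^2 and t_i = s d_i.  There are polynomials G_I in the
   x_J, u_J with |J| < |I| such that x_I = u_I + G_I(x, u) on all mixtures.
   This system is triangular in both directions, so it defines mutually inverse
   polynomial maps between all of the chart and the affine space of the (u, y).
   They identify the secant variety with T_{2,n} x A^n: non-generic points on
   either side are handled by noting that a polynomial vanishing at all but
   finitely many points of a polynomial curve vanishes on the curve. *)

Require Import Defs.
From mathcomp Require Import all_boot all_order all_algebra.
From mathcomp Require Import classical_sets reals.
From mathcomp Require Import complex.
From mathcomp Require Import boolp mpoly zify ring.

Set Implicit Arguments.
Unset Strict Implicit.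
Unset Printing Implicit Defensive.

Import GRing.Theory Num.Theory.
Local Open Scope ring_scope.

(** * Functions that are polynomial in a given family of functions *)

Section PolynomialFunctions.
Variable K : fieldType.

(** The generators [E] are a parameter: they will be coordinates of a space, the parameter of a
    curve, or the moments and cumulants of small sets. *)
Inductive polyfun (X : Type) (E : set (X -> K)) : (X -> K) -> Prop :=
| polyfun_gen f of E f : polyfun E f
| polyfun_const c : polyfun E (fun=> c)
| polyfun_add f g of polyfun E f & polyfun E g : polyfun E (fun x => f x + g x)
| polyfun_mul f g of polyfun E f & polyfun E g : polyfun E (fun x => f x * g x).

Lemma polyfun_ext (X : Type) (E : set (X -> K)) (f g : X -> K) :
  f =1 g -> polyfun E g -> polyfun E f.
Proof. by move/funext => ->. Qed.

Lemma polyfun_sum (X : Type) (E : set (X -> K)) (I : Type) (r : seq I)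
    (P : pred I) (F : I -> X -> K) :
  (forall i, P i -> polyfun E (F i)) ->
  polyfun E (fun x => \sum_(i <- r | P i) F i x).
Proof.
move=> PF; elim: r => [|i r IHr].
  by apply: polyfun_ext (polyfun_const _ _) => x; rewrite big_nil.
case Pi: (P i); last by apply: polyfun_ext IHr => x; rewrite big_cons Pi.
by apply: polyfun_ext (polyfun_add (PF i Pi) IHr) => x; rewrite big_cons Pi.
Qed.

Lemma polyfun_prod (X : Type) (E : set (X -> K)) (I : Type) (r : seq I)
    (P : pred I) (F : I -> X -> K) :
  (forall i, P i -> polyfun E (F i)) ->
  polyfun E (fun x => \prod_(i <- r | P i) F i x).
Proof.
move=> PF; elim: r => [|i r IHr].
  by apply: polyfun_ext (polyfun_const _ _) => x; rewrite big_nil.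
case Pi: (P i); last by apply: polyfun_ext IHr => x; rewrite big_cons Pi.
by apply: polyfun_ext (polyfun_mul (PF i Pi) IHr) => x; rewrite big_cons Pi.
Qed.

Lemma polyfun_exp (X : Type) (E : set (X -> K)) (f : X -> K) (k : nat) :
  polyfun E f -> polyfun E (fun x => f x ^+ k).
Proof.
move=> Ef; elim: k => [|k IHk].
  by apply: polyfun_ext (polyfun_const _ _) => x; rewrite expr0.
by apply: polyfun_ext (polyfun_mul Ef IHk) => x; rewrite exprS.
Qed.

Lemma polyfun_sub (X : Type) (E : set (X -> K)) (f g : X -> K) :
  polyfun E f -> polyfun E g -> polyfun E (fun x => f x - g x).
Proof.
move=> Ef Eg; apply: polyfun_add => //.
apply: polyfun_ext (polyfun_mul (polyfun_const _ (-1)) Eg) => x.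
by rewrite mulN1r.
Qed.

Lemma polyfun_comp (X Y : Type) (E : set (X -> K)) (E' : set (Y -> K))
    (f : X -> K) (h : Y -> X) :
  polyfun E f -> (forall e, E e -> polyfun E' (fun y => e (h y))) ->
  polyfun E' (fun y => f (h y)).
Proof.
move=> Ef EE'; elim: Ef => {f} [f /EE' //|c|f g _ IHf _ IHg|f g _ IHf _ IHg].
- exact: polyfun_const.
- exact: polyfun_add.
- exact: polyfun_mul.
Qed.

Lemma polyfun_eq (X : Type) (E : set (X -> K)) (f : X -> K) (x y : X) :
  polyfun E f -> (forall e, E e -> e x = e y) -> f x = f y.
Proof.
move=> Ef Exy; elim: Ef => {f} [f /Exy //|//|f g _ IHf _ IHg|f g _ IHf _ IHg].
- by rewrite IHf IHg.
- by rewrite IHf IHg.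
Qed.

Definition coordinate (J : finType) : set (coords K J -> K) :=
  [set f | exists j : J, f = fun x : coords K J => x j : K]%classic.

Lemma polyfun_coord (J : finType) (j : J) :
  polyfun (@coordinate J) (fun x : coords K J => x j).
Proof. by apply: polyfun_gen; exists j. Qed.

Definition poly_map (X : Type) (E : set (X -> K)) (J : finType)
  (h : X -> coords K J) := forall j, polyfun E (fun x => h x j).

Lemma polyfun_map (X : Type) (E : set (X -> K)) (J : finType)
    (h : X -> coords K J) (f : coords K J -> K) :
  polyfun (@coordinate J) f -> poly_map E h -> polyfun E (fun x => f (h x)).
Proof. by move=> Ef hP; apply: polyfun_comp Ef _ => _ [j ->]. Qed.

Lemma polyfun_peval (J : finType) (p : {mpoly K[#|J|]}) :
  polyfun (@coordinate J) (peval p).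
Proof.
have -> : peval p = fun x => \sum_(m <- msupp p)
    p@_m * \prod_i (x (enum_val i) : K) ^+ m i.
  by apply/funext => x; rewrite /peval mevalE.
apply: polyfun_sum => m _; apply: polyfun_mul; first exact: polyfun_const.
by apply: polyfun_prod => i _; apply/polyfun_exp/polyfun_coord.
Qed.

Lemma peval_map (X : Type) (E : set (X -> K)) (J : finType)
    (h : X -> coords K J) (p : {mpoly K[#|J|]}) :
  poly_map E h -> polyfun E (fun x => peval p (h x)).
Proof. exact/polyfun_map/polyfun_peval. Qed.

Lemma pevalX (J : finType) (j : J) (x : coords K J) :
  peval 'X_(enum_rank j) x = x j.
Proof. by rewrite /peval mevalXU enum_rankK. Qed.

Lemma polyfun_coordP (J : finType) (f : coords K J -> K) :
  polyfun (@coordinate J) f -> exists p : {mpoly K[#|J|]}, f = peval p.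
Proof.
elim=> {f} [_ [j ->]|c|_ _ _ [p ->] _ [q ->]|_ _ _ [p ->] _ [q ->]].
- by exists 'X_(enum_rank j); apply/funext => x; rewrite pevalX.
- by exists c%:MP; apply/funext => x; rewrite /peval mevalC.
- by exists (p + q); apply/funext => x; rewrite /peval mevalD.
- by exists (p * q); apply/funext => x; rewrite /peval mevalM.
Qed.

Lemma polyfun_idP (f : K -> K) :
  polyfun [set id]%classic f -> exists p : {poly K}, f = horner p.
Proof.
elim=> {f} [_ ->|c|_ _ _ [p ->] _ [q ->]|_ _ _ [p ->] _ [q ->]].
- by exists 'X; apply/funext => x; rewrite hornerX.
- by exists c%:P; apply/funext => x; rewrite hornerC.
- by exists (p + q); apply/funext => x; rewrite hornerD.
- by exists (p * q); apply/funext => x; rewrite hornerM.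
Qed.

(** On the hyperplane [v j = 0] this is the zero vector, a default value; statements about it treat
    that case apart. *)
Definition dehomog (J : finType) (j : J) (v : coords K J) : coords K J :=
  (v j)^-1 *: v.

(* The identity at large degrees [d] lets one bring a numerator and a
   denominator to the same degree. *)
Lemma polyfun_homog (J : finType) (j : J) (f : coords K J -> K) :
  polyfun (@coordinate J) f ->
  exists D, forall d, (D <= d)%N -> exists2 p : {mpoly K[#|J|]}, p \is d.-homog
    & forall v : coords K J, v j != 0 -> peval p v = v j ^+ d * f (dehomog j v).
Proof.
elim=> {f} [_ [k ->]|c|f g _ [D1 H1] _ [D2 H2]|f g _ [D1 H1] _ [D2 H2]].
- exists 1%N => -[//|d] _; exists ('X_(enum_rank j) ^+ d * 'X_(enum_rank k)).
    rewrite -addn1; apply: dhomogM; last by rewrite dhomogX; apply/eqP/mdeg1.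
    rewrite -{2}[d]mul1n; apply: dhomogMn; by rewrite dhomogX; apply/eqP/mdeg1.
  move=> v vj; rewrite /peval mevalM rmorphXn /= -!/(peval _ v) !pevalX.
  by rewrite ffunE /= exprSr -mulrA mulVKf.
- exists 0%N => d _; exists (c *: 'X_(enum_rank j) ^+ d).
    apply: dhomogZ; rewrite -{2}[d]mul1n; apply: dhomogMn.
    by rewrite dhomogX; apply/eqP/mdeg1.
  move=> v vj; rewrite /peval mevalZ rmorphXn /= -!/(peval _ v) !pevalX.
  exact: mulrC.
- exists (maxn D1 D2) => d; rewrite geq_max => /andP[/H1[p ph pE] /H2[q qh qE]].
  exists (p + q); first exact: rpredD.
  by move=> v vj; rewrite mulrDr -pE // -qE // /peval mevalD.
- exists (D1 + D2)%N => d le_d.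
  have [|p ph pE] := H1 D1 _; first by [].
  have le_D1 : (D1 <= d)%N by apply: leq_trans le_d; apply: leq_addr.
  have [|q qh qE] := H2 (d - D1)%N _; first by rewrite leq_subRL.
  have dE : d = (D1 + (d - D1))%N by rewrite subnKC.
  exists (p * q); first by rewrite dE; apply: dhomogM.
  by move=> v vj; rewrite dE exprD mulrACA -pE // -qE // /peval mevalM.
Qed.

End PolynomialFunctions.

(** * Closed sets, and their passage between a chart and projective space *)

Section ZariskiTopology.
Variable K : fieldType.

Lemma affine_closed_preimage (J L : finType) (h : coords K J -> coords K L)
    (N : set (coords K L)) :
  poly_map (@coordinate K J) h -> affine_closed N ->
  affine_closed [set x | N (h x)]%classic.
Proof.
move=> hP [F ->].
exists [set p | exists2 q, F q & peval p = peval q \o h]%classic.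
apply/seteqP; split => [x Nx _ [q /Nx qx ->] //|x Nx q Fq].
have [p pE] := polyfun_coordP (peval_map q hP).
by rewrite [LHS](congr1 (@^~ x) pE); apply: Nx; exists q; rewrite // -pE.
Qed.

(** The polynomials vanishing on [X] are equations for the intersection of all closed sets
    containing [X]. *)
Lemma zclosure_affine_closed (J : finType) (X : set (affine_space K J)) :
  affine_closed (zclosure X).
Proof.
exists [set p | forall x, X x -> peval p x = 0]%classic.
apply/seteqP; split => [x cx p pX|x px M [[F ->] XM] p Fp].
  apply: (cx [set y | peval p y = 0]%classic); split => //.
  exists [set p]%classic; apply/seteqP; split => [y py _ -> //|y py].
  exact: py.
by apply: px => y /XM; apply.
Qed.

Lemma zclosure_proj_closed (J : finType) (X : set (proj_space K J)) :
  proj_closed (zclosure X).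
Proof.
exists [set p | (exists d, p \is d.-homog) /\
  forall P, X P -> forall v, hcoords P v -> peval p v = 0]%classic.
  by move=> p [].
apply/seteqP; split => [P cP p [ph pX]|P pP M [[F Fh ->] XM] p Fp].
  apply: (cP [set Q | forall v, hcoords Q v -> peval p v = 0]%classic).
  split => //; exists [set p]%classic; first by move=> _ ->.
  by apply/seteqP; split => [Q pQ _ -> //|Q pQ]; exact: pQ.
by apply: pP; split => [|Q /XM]; [exact: Fh | exact].
Qed.

(* The factor [X_j] contained in the members of [F] makes the condition hold
   automatically on the hyperplane at infinity [v j = 0]. *)
Lemma chart_closed (J L : finType) (j : J) (f : coords K J -> coords K L)
    (N : set (coords K L)) :
  poly_map (@coordinate K J) f -> affine_closed N ->
  exists2 F : set {mpoly K[#|J|]}, forall p, F p -> exists d, p \is d.-homog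
    & forall v : coords K J, (v j = 0 \/ N (f (dehomog j v))) <->
        (forall p, F p -> peval p v = 0).
Proof.
move=> fP [FN ->].
pose C (v : coords K J) :=
  v j = 0 \/ forall p, FN p -> peval p (f (dehomog j v)) = 0.
exists [set p | (exists d, p \is d.-homog) /\
  forall v, C v -> peval p v = 0]%classic; first by move=> p [].
move=> v; split=> [Cv p [_ pC]|pv]; first exact: pC.
have [v0|v0] := eqVneq (v j) 0; [by left | right => p Np].
have [D /(_ D (leqnn D)) [q qh qE]] := polyfun_homog j (peval_map p fP).
have : peval ('X_(enum_rank j) * q) v = 0.
  apply: pv; split.
    exists (1 + D)%N; apply: dhomogM => //.
    by rewrite dhomogX; apply/eqP/mdeg1.
  move=> u Cu; rewrite /peval mevalM -!/(peval _ u) pevalX.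
  have [->|u0] := eqVneq (u j) 0; first by rewrite mul0r.
  case: Cu => [|Cu]; first by move/eqP; rewrite (negPf u0).
  by rewrite qE // Cu // !mulr0.
rewrite /peval mevalM -!/(peval _ v) pevalX qE // mulrA -exprS => /eqP.
by rewrite mulf_eq0 expf_eq0 (negPf v0) /= => /eqP.
Qed.

(** A closed condition on the chart need not be closed in projective space; its union with the
    hyperplane at infinity is. *)
Lemma chart_proj_closed (J L : finType) (j : J) (f : coords K J -> coords K L)
    (N : set (coords K L)) :
  poly_map (@coordinate K J) f -> affine_closed N ->
  proj_closed [set P : proj K J | forall v : coords K J, hcoords P v ->
    v j = 0 \/ N (f (dehomog j v))]%classic.
Proof.
move=> fP /(chart_closed j fP)[F Fh FE]; exists F => //.
apply/seteqP; split=> [P NP p Fp v /NP/FE|P NP v Pv]; first exact.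
by apply/FE => p Fp; exact: NP.
Qed.

Lemma mkproj_hcoords (J : finType) (v : coords K J) (v0 : v != 0) :
  hcoords (mkproj v0) v.
Proof. by rewrite /hcoords memv_line. Qed.

Lemma hcoords_mkproj (J : finType) (v u : coords K J) (v0 : v != 0) :
  hcoords (mkproj v0) u -> exists2 c, c != 0 & u = c *: v.
Proof.
case/andP => /vlineP[c ->] cv0; exists c => //.
by apply: contraNneq cv0 => ->; rewrite scale0r.
Qed.

Lemma mkproj_eq (J : finType) (P : proj K J) (v : coords K J) (v0 : v != 0) :
  hcoords P v -> mkproj v0 = P.
Proof.
case/andP=> vP _; apply: val_inj; apply/eqP; rewrite eqEdim -memvE vP /=.
by rewrite (eqP (valP P)) dim_vline v0.
Qed.

Lemma peval_homogZ (J : finType) (p : {mpoly K[#|J|]}) (d : nat) (c : K)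
    (v : coords K J) :
  p \is d.-homog -> peval p (c *: v) = c ^+ d * peval p v.
Proof.
move=> ph; rewrite /peval !mevalE big_distrr /=.
rewrite [LHS]big_seq_cond [RHS]big_seq_cond; apply: eq_bigr => m.
rewrite andbT => mp; rewrite mulrCA; congr (_ * _).
have <- : mdeg m = d by apply: (dhomogP _ _ _ ph).
rewrite mdegE -prodrXr -big_split /=; apply: eq_bigr => i _.
by rewrite ffunE exprMn.
Qed.

(** Homogeneous equations may be tested on the single representative [g w], where they become
    polynomial in [w]. *)
Lemma mkproj_preimage_closed (J L : finType) (g : coords K L -> coords K J)
    (g0 : forall w, g w != 0) (Z : set (proj K J)) :
  poly_map (@coordinate K L) g -> proj_closed Z ->
  affine_closed [set w | Z (mkproj (g0 w))]%classic.
Proof.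
move=> gP [F Fh ->].
have := affine_closed_preimage gP (ex_intro _ F erefl); congr affine_closed.
apply/seteqP; split=> w Fw p Fp; last exact/Fw/mkproj_hcoords.
move=> v /hcoords_mkproj[c _ ->]; have [d ph] := Fh _ Fp.
by rewrite (peval_homogZ _ _ ph) Fw ?mulr0.
Qed.

Definition chart_domain (J : finType) (j : J) : set (proj_space K J) :=
  [set P | forall v : coords K J, hcoords P v -> v j != 0]%classic.

Lemma chart_domainP (J : finType) (j : J) (P : proj K J) (v : coords K J) :
  hcoords P v -> chart_domain j P <-> v j != 0.
Proof.
move=> Pv; split=> [|vj u]; first exact.
have /andP[_ v0] := Pv; rewrite -(mkproj_eq v0 Pv).
by case/hcoords_mkproj => c c0 ->; rewrite ffunE; exact: mulf_neq0.
Qed.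

Lemma chart_domain_open (J : finType) (j : J) : zopen (@chart_domain J j).
Proof.
exists [set 'X_(enum_rank j)]%classic.
  by move=> _ ->; exists 1%N; rewrite dhomogX; apply/eqP/mdeg1.
apply/seteqP; split=> P.
  move=> nP _ -> v Pv; rewrite pevalX.
  by apply/eqP/negPn/negP => /(chart_domainP j Pv).
move=> P0 /(_ _ (hcoords_vpick P)); rewrite -pevalX P0 ?eqxx //.
exact: hcoords_vpick.
Qed.

(** * From polynomial inverse maps on a chart to an isomorphism of varieties *)

Section Chart.
Variables (J L : finType) (j : J).
Variables (f : coords K J -> coords K L) (g : coords K L -> coords K J).
Hypothesis fP : poly_map (@coordinate K J) f.
Hypothesis gP : poly_map (@coordinate K L) g.
Hypothesis g0 : forall w, g w != 0.
Hypothesis gj : forall w, g w j = 1.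
Hypothesis fgK : cancel g f.
Hypothesis gfK : forall x : coords K J, x j = 1 -> g (f x) = x.

Variables (X : set (proj_space K J)) (N : set (affine_space K L)).
Hypothesis Xj : (X `<=` chart_domain j)%classic.
Hypothesis XN : forall w, X (mkproj (g0 w)) <-> N w.

Let phi (P : proj_space K J) : affine_space K L :=
  f (dehomog j (pick_coords P)).
Let psi (w : affine_space K L) : proj_space K J := mkproj (g0 w).

Let dehomogj (v : coords K J) : v j != 0 -> dehomog j v j = 1.
Proof. by move=> vj; rewrite ffunE; exact: mulVf. Qed.

Let phiK P : X P -> psi (phi P) = P.
Proof.
move=> XP; have vj := Xj XP (hcoords_vpick P).
apply: mkproj_eq; rewrite /phi gfK ?dehomogj //.
case/andP: (hcoords_vpick P) => vP v0; rewrite /hcoords /dehomog memvZ //=.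
by rewrite scaler_eq0 invr_eq0 negb_or vj v0.
Qed.

Let phiE P v : X P -> hcoords P v -> phi P = f (dehomog j v).
Proof.
move=> XP Pv; have vj := Xj XP Pv; case/andP: (Pv) => _ v0.
have := hcoords_vpick P; rewrite -{1}(mkproj_eq v0 Pv).
case/hcoords_mkproj => c c0; rewrite /phi /pick_coords => ->.
congr f; apply/ffunP => k; rewrite !ffunE /=.
rewrite -[LHS]/((c * v j)^-1 * (c * v k)) invfM mulrACA mulVf // mul1r.
by [].
Qed.

Let psiK w : phi (psi w) = w.
Proof.
have /hcoords_mkproj[c c0 cE] := hcoords_vpick (psi w).
rewrite /phi /pick_coords cE.
rewrite -[RHS]fgK; congr f; apply/ffunP => k; rewrite !ffunE /= gj.
rewrite -[_ *: 1]/(c * 1) -[_ *: g w k]/(c * g w k) mulr1.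
exact: mulKf.
Qed.

Let phi_map P : X P -> N (phi P).
Proof. by move=> XP; apply/XN; rewrite -/(psi _) phiK. Qed.

Let phi_open (O : set (affine_space K L)) : zopen O ->
  exists2 O' : set (proj_space K J), zopen O' &
    forall P, X P -> O' P <-> O (phi P).
Proof.
move=> /(chart_proj_closed j fP) cO.
(* The complement of [O] is pulled back together with the hyperplane at infinity, which [X]
   misses. *)
exists (~` [set P : proj K J | forall v : coords K J,
  hcoords P v -> v j = 0 \/ ~ O (f (dehomog j v))])%classic.
  by rewrite /zopen setCK; exact: cO.
move=> P XP /=; split => [nP|OP nP].
  apply: contrapT => nO; apply: nP => v Pv; right => /=.
  by rewrite -(phiE XP Pv).
have Pv := hcoords_vpick P.
case: (nP _ Pv) => [/eqP|]; first by rewrite (negPf (Xj XP Pv)).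
by apply; rewrite -(phiE XP Pv).
Qed.

(** Regular functions are local quotients. Along [psi] one substitutes [g]; along [phi] one
    homogenises, so only the pointwise comparison [XN] remains to be supplied. *)
Lemma chart_isomorphic : isomorphic X N.
Proof.
exists phi, psi; split => //.
- split=> // [O /phi_open[O' O'o O'E]|O h /phi_open[O' O'o O'E]].
    exists O' => //; apply/seteqP.
    by split=> P [XP OP]; split=> //; apply/(O'E _ XP).
  move=> hr P [XP OP].
  have [W [a [b [cW Wx hE]]]] := hr (phi P) (conj (phi_map XP) OP).
  have [W' W'o W'E] := phi_open cW.
  have [Da HDa] := polyfun_homog j (peval_map a fP).
  have [Db HDb] := polyfun_homog j (peval_map b fP).
  (* With a common degree for numerator and denominator, the powers of [v j] cancel in the
     quotient. *)
  have [a' a'h a'E] := HDa _ (leq_maxl Da Db).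
  have [b' b'h b'E] := HDb _ (leq_maxr Da Db).
  exists W', (maxn Da Db), a', b'; split => //.
    by apply/(W'E _ XP).
  move=> Q v [XQ OQ] /(W'E _ XQ) WQ Qv; have vj := Xj XQ Qv.
  have [b0 hQ] := hE _ (conj (phi_map XQ) OQ) WQ.
  have vD0 : v j ^+ maxn Da Db != 0 by rewrite expf_neq0.
  rewrite b'E // a'E // -(phiE XQ Qv) mulf_neq0 //=; split=> //.
  by rewrite hQ -mulf_div divff // mul1r.
- split=> [w /XN //|O cO|O h oO hr w [Nw Ow]].
    exists (psi @^-1` O)%classic => //.
    rewrite /zopen; have := mkproj_preimage_closed g0 gP cO.
    exact.
  have [W [d [a [b [cW Ww ah bh hE]]]]] := hr (psi w) (conj ((XN w).2 Nw) Ow).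
  have [a' a'E] := polyfun_coordP (peval_map a gP).
  have [b' b'E] := polyfun_coordP (peval_map b gP).
  exists (psi @^-1` W)%classic, a', b'; split => //.
    exact: (mkproj_preimage_closed g0 gP cW).
  move=> y [Ny Oy] Wy; rewrite -a'E -b'E.
  exact: (hE (psi y) (g y) (conj ((XN y).2 Ny) Oy) Wy (mkproj_hcoords _)).
Qed.

End Chart.
End ZariskiTopology.

(** * Polynomial curves in closed sets *)

Section Curves.
Variable K : numFieldType.

Lemma poly_eq0_fun (p : {poly K}) : (forall e, p.[e] = 0) -> p = 0.
Proof.
move=> p0; apply/eqP/negPn/negP => /max_poly_roots.
(* In characteristic zero these are [size p] distinct roots, one more than the degree allows. *)
move=> /(_ [seq i%:R | i <- iota 0 (size p)]).
rewrite size_map size_iota ltnn => H; suff: false by [].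
apply: H; first by apply/allP => x _; apply/eqP.
by rewrite map_inj_uniq ?iota_uniq // => m k /eqP; rewrite eqr_nat => /eqP.
Qed.

Lemma curve_closed (J : finType) (N : set (coords K J)) (c : K -> coords K J)
    (w : {poly K}) :
  affine_closed N -> poly_map [set id]%classic c -> w != 0 ->
  (forall e, w.[e] != 0 -> N (c e)) -> forall e, N (c e).
Proof.
move=> [F ->] cP w0 Nc e p Fp.
have [q qE] := polyfun_idP (peval_map p cP).
rewrite [LHS](congr1 (@^~ e) qE) /=.
suff -> : q = 0 by rewrite horner0.
(* Where [w] vanishes nothing is known of [q], but the product vanishes everywhere. *)
have /eqP : q * w = 0.
  apply: poly_eq0_fun => x; rewrite hornerM -qE.
  have [->|wx] := eqVneq w.[x] 0; first by rewrite mulr0.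
  by rewrite (Nc _ wx) ?mul0r.
by rewrite mulf_eq0 (negPf w0) orbF => /eqP.
Qed.

End Curves.

(** * The triangular change of coordinates between moments and cumulants *)

Section Cumulants.
Variables (K : fieldType) (n : nat).
Local Notation T := {set 'I_n}.
Local Notation X := (coords K T * coords K T)%type.
Implicit Types (p : K) (a b : 'I_n -> K) (I J A C : T).

(* The normalised points of the secant variety: the line through two Segre
   points [(a i : 1)], [(b i : 1)] consists of the moments of a mixture of two
   product measures. *)
Definition mixture p a b : coords K T :=
  [ffun I : T => p * \prod_(i in I) a i + (1 - p) * \prod_(i in I) b i].

(** Sets of size at most one keep their moments: the normalisation 1 at the empty set, and the
    means, which become the coordinates on the affine factor. *)
Definition cumulant p a b : coords K T :=
  [ffun I : T => if (#|I| <= 1)%N then mixture p a b I else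
     p * (1 - p) * (1 - p *+ 2) ^+ (#|I| - 2) * \prod_(i in I) (a i - b i)].

Definition lower (k : nat) : set (X -> K) :=
  [set e | exists2 I : T, (#|I| < k)%N &
     (e = fun xu : X => xu.1 I) \/ (e = fun xu : X => xu.2 I)]%classic.

Lemma polyfun_lowerW (k l : nat) (f : X -> K) :
  (k <= l)%N -> polyfun (lower k) f -> polyfun (lower l) f.
Proof.
move=> kl /polyfun_comp H; apply: (H _ _ id) => e [I Ik eE].
by apply: polyfun_gen; exists I => //; apply: leq_trans kl.
Qed.

Lemma polyfun_lower1 (k : nat) I :
  (#|I| < k)%N -> polyfun (lower k) (fun xu : X => xu.1 I).
Proof. by move=> Ik; apply: polyfun_gen; exists I => //; left. Qed.

Lemma polyfun_lower2 (k : nat) I :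
  (#|I| < k)%N -> polyfun (lower k) (fun xu : X => xu.2 I).
Proof. by move=> Ik; apply: polyfun_gen; exists I => //; right. Qed.

(* Write [x] for the mixture, [u] for its cumulants and [y i = x {i}].  With
   [b_A] the difference of the two products over [A], [d = a - b],
   [s = 1 - 2 p], one has
   [b_{A + j} = x_A * d_j + b_A * (y_j + s * d_j)].
   Iterating this recursion turns the left-hand side below into a polynomial
   in [x] and [u] whose only term of top degree is [u_{A + C}]. *)
Lemma cumulant_expansion A C :
  A != finset.set0 -> C != finset.set0 -> [disjoint A & C] ->
  exists2 G : X -> K, polyfun (lower (#|A| + #|C|)) G & forall p a b,
    p * (1 - p) * (1 - p *+ 2) ^+ (#|C| - 1) * \prod_(i in C) (a i - b i)
      * (\prod_(i in A) a i - \prod_(i in A) b i)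
    = cumulant p a b (A :|: C) + G (mixture p a b, cumulant p a b).
Proof.
(* [C] stays general because the recursion moves [j] from [A] into [C]. *)
move Ek : #|A| => k; elim: k A C Ek => [|k IHk] A C Ek A0 C0 AC.
  by move: A0; rewrite -card_gt0 Ek.
have /set0Pn[j jA] := A0.
have jC : j \notin C by rewrite (disjointFr AC).
have cA' : #|A :\ j| = k by apply/eqP; rewrite -eqSS -Ek (cardsD1 j A) jA.
have cC : (0 < #|C|)%N by rewrite card_gt0.
have A'j : A = j |: (A :\ j) by rewrite finset.setD1K.
have cjC : #|j |: C| = #|C|.+1 by rewrite cardsU1 jC.
have prodA F : \prod_(i in A) F i = F j * \prod_(i in A :\ j) F i :> K.
  by rewrite (big_setD1 j).
have prodC F : \prod_(i in j |: C) F i = F j * \prod_(i in C) F i :> K.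
  by rewrite big_setU1.
have A'C : [disjoint A :\ j & C].
  by apply: disjointWl AC; apply: finset.subD1set.
have cU : #|A :|: C| = (k.+1 + #|C|)%N.
  by rewrite cardsU (finset.disjoint_setI0 AC) cards0 subn0 Ek.
(* For [A] a singleton the left-hand side is already the cumulant of [A :|: C]. *)
have [A'0|A'0] := eqVneq (A :\ j) finset.set0.
  exists (fun=> 0); first exact: polyfun_const.
  move=> p a b; rewrite addr0 ffunE cU.
  have k0 : k = 0%N by rewrite -cA' A'0 cards0.
  rewrite k0 add1n ltnNge cC /= subSS.
  rewrite !prodA A'0 !big_set0 !mulr1 A'j A'0 finset.setU0 prodC.
  by ring.
have kgt0 : (0 < k)%N by rewrite -cA' card_gt0.
have [G1 G1P G1E] := IHk _ _ cA' A'0 C0 A'C.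
have jC0 : j |: C != finset.set0 by rewrite -card_gt0 cjC.
have A'jC : [disjoint A :\ j & j |: C].
  rewrite finset.disjoints_subset; apply/fintype.subsetP => i iA'.
  rewrite !inE negb_or (disjointFr A'C iA') andbT.
  by move: iA'; rewrite !inE => /andP[].
have [G2 G2P G2E] := IHk _ _ cA' A'0 jC0 A'jC.
have EU : (A :\ j) :|: (j |: C) = A :|: C.
  by rewrite finset.setUA (finset.setUC _ [set j]%SET) -A'j.
(* One summand per term of the recursion: the [d_j] term, the [y_j] term through [G1E], and the
   [s * d_j] term through [G2E]. Only the last yields the top cumulant, which is split off here. *)
exists (fun xu : X => xu.1 (A :\ j) * xu.2 (j |: C) +
  (xu.1 [set j]%SET * (xu.2 ((A :\ j) :|: C) + G1 xu) + G2 xu)).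
  apply: polyfun_add; first apply: polyfun_mul.
  - by apply: polyfun_lower1; rewrite cA'; lia.
  - by apply: polyfun_lower2; rewrite cjC; lia.
  apply: polyfun_add; first apply: polyfun_mul.
  - by apply: polyfun_lower1; rewrite cards1; lia.
  - apply: polyfun_add; last by apply: polyfun_lowerW G1P; lia.
    apply: polyfun_lower2.
    by rewrite cardsU (finset.disjoint_setI0 A'C) cards0 cA'; lia.
  - by apply: polyfun_lowerW G2P; rewrite cjC; lia.
move=> p a b; rewrite -EU /= [RHS]addrCA [X in _ = _ + X]addrCA -G2E -G1E.
rewrite !prodA prodC.
have -> : cumulant p a b (j |: C) = p * (1 - p) * (1 - p *+ 2) ^+ (#|C| - 1)
     * ((a j - b j) * \prod_(i in C) (a i - b i)).
  by rewrite ffunE cjC ltnNge cC /= prodC; congr (_ * _ ^+ _ * _); lia.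
rewrite cjC subSS subn0 !ffunE !big_set1.
have -> : #|C| = (#|C| - 1).+1 by lia.
rewrite exprS subSS subn0.
move: (\prod_(_ in C) _) (_ ^+ _) (\prod_(_ in _) a _) (\prod_(_ in _) b _).
move=> D S P Q; ring.
Qed.

(** For [i] in [I], the covariance [x_I - x_{I - i} * x_i] equals [p (1 - p) (a_i - b_i)] times the
    difference of the two products over [I - i]: this is the previous expansion with [C] the
    singleton of [i]. *)
Lemma mixture_expansion I :
  exists2 G : X -> K, polyfun (lower #|I|) G /\
    ((#|I| <= 1)%N -> forall xu, G xu = 0)
  & forall p a b, mixture p a b I =
      cumulant p a b I + G (mixture p a b, cumulant p a b).
Proof.
have [I1|I1] := leqP #|I| 1.
  exists (fun=> 0); first by split=> //; exact: polyfun_const.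
  by move=> p a b; rewrite [in RHS]ffunE I1 addr0.
have /set0Pn[i iI] : I != finset.set0 by rewrite -card_gt0 ltnW.
have cI : #|I| = (#|I :\ i| + #|[set i]%SET|)%N.
  by rewrite (cardsD1 i) iI cards1 addnC.
have A0 : I :\ i != finset.set0.
  by rewrite -card_gt0; move: cI I1; rewrite cards1; lia.
have C0 : [set i]%SET != finset.set0 by rewrite -card_gt0 cards1.
have AC : [disjoint I :\ i & [set i]].
  by rewrite disjoint_sym finset.disjoints1 !inE eqxx.
have [G GP GE] := cumulant_expansion A0 C0 AC.
exists (fun xu : X => xu.1 (I :\ i) * xu.1 [set i]%SET + G xu).
  split=> //.
  apply: polyfun_add; last by rewrite cI.
  apply: polyfun_mul; apply: polyfun_lower1; rewrite ?cards1 //.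
  by rewrite cI cards1; lia.
move=> p a b; rewrite addrCA /=; move: (GE p a b).
rewrite finset.setUC finset.setD1K // => <-.
rewrite cards1 subnn expr0 !big_set1 !ffunE.
rewrite !(big_setD1 i iI) /= !big_set1.
move: (\prod_(_ in _) a _) (\prod_(_ in _) b _) => P Q; ring.
Qed.

(** The first component is the given data, unrestricted; the second is the unknown, allowed only on
    small sets. *)
Definition lower_second (k : nat) : set (X -> K) :=
  [set e | (exists I : T, e = fun xu : X => xu.1 I) \/
     (exists2 I : T, (#|I| < k)%N & e = fun xu : X => xu.2 I)]%classic.

(** Iterate the system from 0. After [k] rounds the entries on sets of size less than [k] are final,
    so [n.+1] rounds settle all of them. *)
Lemma triangular_solution (H : T -> X -> K) :
  (forall I, polyfun (lower_second #|I|) (H I)) ->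
  exists2 f : coords K T -> coords K T, poly_map (@coordinate K T) f
    & forall x u : coords K T, (forall I, u I = H I (x, u)) <-> u = f x.
Proof.
move=> HP.
pose f := fix f k x : coords K T :=
  if k is k'.+1 then [ffun I => H I (x, f k' x)] else 0.
have HE x I (u v : coords K T) : (forall J, (#|J| < #|I|)%N -> u J = v J) ->
    H I (x, u) = H I (x, v).
  by move=> uv; apply: (polyfun_eq (HP I)) => e [[J ->]|[J /uv JI ->]].
have fS k (x : coords K T) I : (#|I| < k)%N -> f k.+1 x I = f k x I.
  elim: k I => // k IHk I Ik; rewrite [in LHS]/= [in RHS]/= !ffunE.
  by apply: HE => J JI; apply: IHk; apply: leq_trans JI _.
have fP k : poly_map (@coordinate K T) (f k).
  elim: k => [|k IHk] I.
    by apply: polyfun_ext (polyfun_const _ 0) => x /=; rewrite ffunE.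
  apply: (@polyfun_ext _ _ _ _ (fun x => H I (x, f k x))).
    by move=> x /=; rewrite ffunE.
  apply: polyfun_comp (HP I) _ => e [[J ->]|[J _ ->]] //=.
  exact: polyfun_coord.
have lt_n I : (#|I| < n.+1)%N by rewrite ltnS -[leqRHS]card_ord max_card.
exists (f n.+1); first exact: fP.
move=> x u; split=> [uE|-> I]; last by rewrite -fS //= ffunE.
suff uf k I : (#|I| < k)%N -> u I = f k x I.
  by apply/ffunP => I; apply: uf.
elim: k I => // k IHk I Ik; rewrite uE /= ffunE.
by apply: HE => J JI; apply: IHk; apply: leq_trans JI _.
Qed.

(** The equations [x_I = u_I + G_I(x, u)] are triangular in [u] for given [x] and in [x] for given
    [u]. Both solution maps have the same graph, hence are mutually inverse. *)
Lemma cumulant_change :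
  exists Phi Psi : coords K T -> coords K T,
  [/\ poly_map (@coordinate K T) Phi /\ poly_map (@coordinate K T) Psi,
      cancel Phi Psi /\ cancel Psi Phi,
      forall (x : coords K T) I, (#|I| <= 1)%N -> Phi x I = x I /\ Psi x I = x I
    & forall p a b, Phi (mixture p a b) = cumulant p a b /\
        Psi (cumulant p a b) = mixture p a b].
Proof.
pose Q I (G : X -> K) := [/\ polyfun (lower #|I|) G,
  (#|I| <= 1)%N -> forall xu, G xu = 0
  & forall p a b, mixture p a b I =
      cumulant p a b I + G (mixture p a b, cumulant p a b)].
have /choice[G GQ] : forall I, exists G, Q I G.
  by move=> I; have [G [? ?] ?] := mixture_expansion I; exists G.
have GP I : polyfun (lower #|I|) (G I) by case: (GQ I).
have /triangular_solution[Phi PhiP /= PhiE] :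
    forall I, polyfun (lower_second #|I|) (fun xu : X => xu.1 I - G I xu).
  move=> I.
  apply: polyfun_sub; first by apply: polyfun_gen; left; exists I.
  apply: (polyfun_comp (h := id) (GP I)) => _ [J JI [->|->]];
    apply: polyfun_gen; [by left; exists J | by right; exists J].
(* The components are exchanged: now the cumulants are the data and the moments the unknown. *)
have /triangular_solution[Psi PsiP /= PsiE] : forall I,
    polyfun (lower_second #|I|) (fun ux : X => ux.1 I + G I (ux.2, ux.1)).
  move=> I.
  apply: polyfun_add; first by apply: polyfun_gen; left; exists I.
  apply: (polyfun_comp (h := fun ux : X => (ux.2, ux.1)) (GP I)).
  move=> _ [J JI [->|->]] /=;
    apply: polyfun_gen; [by right; exists J | by left; exists J].
have relE (x u : coords K T) : u = Phi x <-> x = Psi u.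
  rewrite -PhiE -PsiE; split=> H I; first by rewrite [in RHS]H subrK.
  by rewrite [in RHS]H addrK.
have mixE p a b : mixture p a b = Psi (cumulant p a b).
  by apply/PsiE => I; case: (GQ I).
exists Phi, Psi; split => //.
- by split=> x; apply/esym/relE.
- move=> x I I1; have [_ G0 _] := GQ I; split.
    by have /(_ I) := (PhiE x (Phi x)).2 erefl; rewrite G0 // subr0.
  by have /(_ I) := (PsiE x (Psi x)).2 erefl; rewrite G0 // addr0.
- by move=> p a b; split; [apply/esym/relE | ].
Qed.

End Cumulants.

(** * Coordinates on the charts, and the exchange of charts *)

Section SecantCharts.
Variables (K : fieldType) (n : nat).
Local Notation T := {set 'I_n}.
Local Notation L := (big_subset n + 'I_n)%type.

(** The default 1 is reached only at the empty set, where it is the normalisation of the chart. *)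
Definition glue (w : coords K L) : coords K T :=
  [ffun I : T =>
     if (insub I : option (big_subset n)) is Some B then w (inl B) else
     if [pick i | I == [set i]%SET] is Some i then w (inr i) else (1 : K)].

Definition unglue (u : coords K T) : coords K L :=
  [ffun k : L => match k with inl B => u (val B) | inr i => u [set i]%SET end].

Lemma glueK : cancel glue unglue.
Proof.
move=> w; apply/ffunP => -[B|i]; rewrite !ffunE; first by rewrite valK.
rewrite insubN ?cards1 //; case: pickP => [k /eqP/finset.set1_inj -> //|].
by move/(_ i); rewrite eqxx.
Qed.

Lemma unglueK (u : coords K T) : u finset.set0 = 1 -> glue (unglue u) = u.
Proof.
move=> u0; apply/ffunP => I; rewrite ffunE.
case: insubP => [B _ BI|]; first by rewrite ffunE BI.
rewrite -ltnNge ltnS => I1.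
case: pickP => [i /eqP ->|nI]; first by rewrite ffunE.
move: I1; rewrite leq_eqVlt ltnS leqn0 => /orP[/cards1P[i Ii]|].
  by have := nI i; rewrite Ii eqxx.
by rewrite cards_eq0 => /eqP ->.
Qed.

Lemma glue_set0 w : glue w finset.set0 = 1.
Proof.
rewrite ffunE insubN ?cards0 //; case: pickP => // i /eqP.
by move/(congr1 (fun A : T => #|A|)); rewrite cards0 cards1.
Qed.

(* Exchanging the two coordinates of the factors in [S] moves the chart
   [x_set0 != 0] to the chart [x_S != 0]. *)
Definition symdiff (S I : T) : T := [set i | (i \in S) (+) (i \in I)]%SET.

Lemma symdiffK S : involutive (symdiff S).
Proof. by move=> I; apply/finset.setP => i; rewrite !inE addbA addbb. Qed.

Lemma symdiff0 S : symdiff S finset.set0 = S.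
Proof. by apply/finset.setP => i; rewrite !inE addbF. Qed.

Lemma symdiffv S : symdiff S S = finset.set0.
Proof. by apply/finset.setP => i; rewrite !inE addbb. Qed.

Definition relabel (S : T) (x : coords K T) : coords K T :=
  [ffun I : T => x (symdiff S I)].

Lemma relabelK S : involutive (relabel S).
Proof. by move=> x; apply/ffunP => I; rewrite !ffunE symdiffK. Qed.

Lemma relabel_poly S : poly_map (@coordinate K T) (relabel S).
Proof.
move=> I; apply: polyfun_ext (polyfun_coord K (symdiff S I)) => x.
by rewrite ffunE.
Qed.

Lemma glue_poly : poly_map (@coordinate K L) glue.
Proof.
move=> I; case: (insubP (big_subset n : subType _) I) => [B _ BI|nI].
  apply: polyfun_ext (polyfun_coord K (inl B)) => w.
  by rewrite ffunE -BI valK.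
case EI: [pick i | I == [set i]%SET] => [i|].
  apply: polyfun_ext (polyfun_coord K (inr i)) => w.
  by rewrite ffunE insubN // EI.
by apply: polyfun_ext (polyfun_const _ 1) => w; rewrite ffunE insubN // EI.
Qed.

Lemma unglue_poly : poly_map (@coordinate K T) unglue.
Proof.
move=> [B|i].
  by apply: polyfun_ext (polyfun_coord K (val B)) => u; rewrite ffunE.
by apply: polyfun_ext (polyfun_coord K [set i]%SET) => u; rewrite ffunE.
Qed.

Lemma poly_map_comp (U : Type) (E : set (U -> K)) (J M : finType)
    (f : coords K J -> coords K M) (h : U -> coords K J) :
  poly_map (@coordinate K J) f -> poly_map E h -> poly_map E (f \o h).
Proof. by move=> fP hP k; apply: polyfun_map (fP k) hP. Qed.

Definition swap_at (S : T) (a : 'I_n -> coords K 'I_2) (i : 'I_n) :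
    coords K 'I_2 :=
  if i \in S then [ffun k : 'I_2 => a i (rev_ord k)] else a i.

Lemma segre_vecE (a : 'I_n -> coords K 'I_2) I :
  segre_vec a I = \prod_i (a i (if i \in I then 0 else 1) : K).
Proof.
rewrite ffunE [RHS](bigID (mem I)) /=; congr (_ * _).
  by apply: eq_bigr => i ->.
by apply: eq_big => [i|i]; rewrite !inE // => /negPf ->.
Qed.

Lemma segre_swap S (a : 'I_n -> coords K 'I_2) :
  segre_vec (swap_at S a) = relabel S (segre_vec a).
Proof.
apply/ffunP => I; rewrite [RHS]ffunE !segre_vecE; apply: eq_bigr => i _.
rewrite /swap_at !inE; case: ifP => _; last by case: (i \in I).
by rewrite ffunE; case: (i \in I); congr (a i _); apply: val_inj.
Qed.

Lemma swap_at_neq0 S (a : 'I_n -> coords K 'I_2) :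
  (forall i, a i != 0) -> forall i, swap_at S a i != 0.
Proof.
move=> a0 i; rewrite /swap_at; case: ifP => // _.
apply: contra (a0 i) => /eqP/ffunP ai0; apply/eqP/ffunP => k.
by have := ai0 (rev_ord k); rewrite !ffunE rev_ordK.
Qed.

Lemma segre_vec_ratio (a : 'I_n -> coords K 'I_2) I :
  (forall i, a i 1 != 0) ->
  segre_vec a I = (\prod_i (a i 1 : K)) * \prod_(i in I) (a i 0 / a i 1 : K).
Proof.
move=> a1; rewrite segre_vecE (bigID (mem I)).
rewrite [X in _ = X * _](bigID (mem I)) /=.
rewrite mulrAC -big_split /=; congr (_ * _).
  by apply: eq_bigr => i ->; rewrite mulrC divfK.
by apply: eq_bigr => i /negPf ->.
Qed.

(** After the swap at [S], both Segre vectors are scalars times products of ratios. The scalars,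
    multiplied by [c1] and [c2], are weights with sum [v S]; dividing by it gives [p] and
    [1 - p]. *)
Lemma segre_mixture S (c1 c2 : K) (a b : 'I_n -> coords K 'I_2)
    (v := c1 *: segre_vec a + c2 *: segre_vec b) :
  (forall i k, a i k != 0) -> (forall i k, b i k != 0) -> v S != 0 ->
  exists p a' b', relabel S (dehomog S v) = mixture p a' b'.
Proof.
move=> a0 b0 vS.
have swap1 (d : 'I_n -> coords K 'I_2) : (forall i k, d i k != 0) ->
    forall i, swap_at S d i 1 != 0.
  by move=> d0 i; rewrite /swap_at; case: ifP => // _; rewrite ffunE.
pose A := c1 * \prod_i (swap_at S a i 1 : K).
pose B := c2 * \prod_i (swap_at S b i 1 : K).
have rvE I : relabel S v I =
    A * \prod_(i in I) (swap_at S a i 0 / swap_at S a i 1 : K) +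
    B * \prod_(i in I) (swap_at S b i 0 / swap_at S b i 1 : K) :> K.
  rewrite /A /B -!mulrA -!segre_vec_ratio; do ?exact: swap1.
  by rewrite !segre_swap !ffunE.
move: A B rvE => A B rvE.
have vSE : v S = A + B :> K.
  have := rvE finset.set0; rewrite !big_set0 !mulr1 => <-.
  by rewrite [RHS]ffunE symdiff0.
exists (A / (v S : K)), (fun i => swap_at S a i 0 / swap_at S a i 1),
  (fun i => swap_at S b i 0 / swap_at S b i 1).
apply/ffunP => I; rewrite [RHS]ffunE.
have -> : 1 - A / v S = B / v S :> K.
  by rewrite -[1](divff vS) -mulrBl {1}vSE addrC addKr.
have -> : relabel S (dehomog S v) I = (v S)^-1 * relabel S v I :> K.
  by rewrite 2![LHS]ffunE [relabel S v I]ffunE.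
by rewrite rvE mulrDr !mulrA (mulrC _ A) (mulrC _ B).
Qed.

End SecantCharts.

(** * Degenerate points as limits along curves *)

Section SecantClosure.
Variables (K : numFieldType) (n : nat).
Local Notation T := {set 'I_n}.

(* For [q, s, d] nonzero this is the torus point with [t0 = q / s ^+ 2] and
   [t i = s * d i]. *)
Lemma T2_cumulant (q s : K) (d : 'I_n -> K) :
  T2 K n [ffun I : big_subset n =>
    q * s ^+ (#|val I| - 2) * \prod_(i in val I) d i].
Proof.
(* All parameters are shifted by the same [e]; the roots of [w] are the shifts at which one of them
   becomes zero. *)
pose c e : coords K (big_subset n) := [ffun I : big_subset n =>
  (q + e) * (s + e) ^+ (#|val I| - 2) * \prod_(i in val I) (d i + e)].
pose w : {poly K} := ('X + q%:P) * ('X + s%:P) * \prod_i ('X + (d i)%:P).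
suff : T2 K n (c 0).
  congr (T2 K n); apply/ffunP => I; rewrite !ffunE !addr0; congr (_ * _).
  by apply: eq_bigr => i _; rewrite addr0.
have shift0 (x : K) : 'X + x%:P != 0 :> {poly K}.
  by rewrite -size_poly_eq0 size_XaddC.
apply: (curve_closed (w := w)); first exact: zclosure_affine_closed.
- have addP x : polyfun [set id]%classic (fun e : K => x + e).
    by apply: polyfun_add; [exact: polyfun_const | exact: polyfun_gen].
  move=> I; apply: (@polyfun_ext _ _ _ _ (fun e => (q + e) *
      (s + e) ^+ (#|val I| - 2) * \prod_(i in val I) (d i + e))).
    by move=> e; rewrite ffunE.
  apply: polyfun_mul; last by apply: polyfun_prod.
  by apply: polyfun_mul => //; apply: polyfun_exp.
- by rewrite !mulf_neq0 //; apply/prodf_neq0.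
move=> e; rewrite /w !hornerM horner_prod !hornerD !hornerX !hornerC.
rewrite !mulf_eq0 !negb_or -andbA.
case/and3P=> q0 s0 /prodf_neq0 d0.
apply: sub_gen_smallest => /=.
exists ((q + e) / (s + e) ^+ 2), (fun i => (s + e) * (d i + e)).
have s0' : s + e != 0 by rewrite addrC.
split.
- by rewrite mulf_neq0 ?invr_eq0 ?expf_neq0 // addrC.
- move=> i; rewrite mulf_neq0 //.
  by have := d0 i isT; rewrite !hornerE addrC.
apply/ffunP => I; rewrite !ffunE big_split /= prodr_const mulrA; congr (_ * _).
rewrite -mulrA; congr (_ * _).
by rewrite -{2}(subnKC (valP I)) exprD mulKf // expf_neq0.
Qed.

(* Degenerate points, such as those on lines through Segre points at infinity,
   are limits of generic ones under [a i k + e], [b i k + e]. *)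
Lemma secant_vec_closed (Z : set (coords K T)) (c1 c2 : K) :
  affine_closed Z ->
  (forall a b : 'I_n -> coords K 'I_2,
    (forall i k, a i k != 0) -> (forall i k, b i k != 0) ->
    Z (c1 *: segre_vec a + c2 *: segre_vec b)) ->
  forall a b : 'I_n -> coords K 'I_2, Z (c1 *: segre_vec a + c2 *: segre_vec b).
Proof.
move=> Zcl Zab a b.
pose sh (d : 'I_n -> coords K 'I_2) e i : coords K 'I_2 :=
  [ffun k : 'I_2 => d i k + e].
pose c e := c1 *: segre_vec (sh a e) + c2 *: segre_vec (sh b e).
have sh0 d : sh d 0 = d.
  by apply/funext => i; apply/ffunP => k; rewrite ffunE addr0.
rewrite -[a]sh0 -[b]sh0 -/(c 0).
pose w (d : 'I_n -> coords K 'I_2) : {poly K} :=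
  \prod_i \prod_k ('X + (d i k : K)%:P).
have w0 d : w d != 0.
  apply/prodf_neq0 => i _; apply/prodf_neq0 => k _.
  by rewrite -size_poly_eq0 size_XaddC.
have wE d e : (w d).[e] != 0 -> forall i k, sh d e i k != 0.
  rewrite horner_prod => /prodf_neq0 H i k; have := H i isT.
  rewrite horner_prod => /prodf_neq0/(_ k isT).
  by rewrite hornerD hornerX hornerC ffunE addrC.
have shP d I : polyfun [set id]%classic (fun e => segre_vec (sh d e) I : K).
  apply: (@polyfun_ext _ _ _ _
    (fun e => \prod_i (d i (if i \in I then 0 else 1%R) + e : K))).
    by move=> e; rewrite segre_vecE; apply: eq_bigr => i _; rewrite ffunE.
  apply: polyfun_prod => i _.
  by apply: polyfun_add; [exact: polyfun_const | exact: polyfun_gen].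
apply: (curve_closed (c := c) (w := w a * w b)) => //.
- move=> I; apply: (@polyfun_ext _ _ _ _ (fun e =>
    c1 * (segre_vec (sh a e) I : K) + c2 * (segre_vec (sh b e) I : K))).
    by move=> e; rewrite [LHS]ffunE; congr (_ + _); rewrite [LHS]ffunE.
  by apply: polyfun_add; apply: polyfun_mul => //; exact: polyfun_const.
- by rewrite mulf_neq0.
move=> e; rewrite hornerM mulf_eq0 negb_or => /andP[/wE ae /wE be].
exact: Zab.
Qed.

End SecantClosure.

(** * Each chart of the secant variety is the product *)

Section SecantVariety.
Variables (K : numClosedFieldType) (n : nat).
Local Notation T := {set 'I_n}.
Local Notation L := (big_subset n + 'I_n)%type.
Local Notation N := (affine_prod (T2 K n) (affine_n K n)).

Lemma product_closed : affine_closed (N : set (coords K L)).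
Proof.
pose h (z : coords K L) : coords K (big_subset n) := [ffun j => z (inl j)].
have hP : poly_map (@coordinate K L) h.
  by move=> j; apply: polyfun_ext (polyfun_coord K (inl j)) => z; rewrite ffunE.
suff -> : (N : set (coords K L)) = [set z | T2 K n (h z)]%classic.
  exact: affine_closed_preimage hP (zclosure_affine_closed _).
by apply/seteqP; split=> [z []|z Hz]; [|split].
Qed.

Lemma unglue_cumulant p (a b : 'I_n -> K) : N (unglue (cumulant p a b)).
Proof.
split => //.
have := @T2_cumulant K n (p * (1 - p)) (1 - p *+ 2) (fun i => a i - b i).
congr (T2 K n); apply/ffunP => I; rewrite !ffunE /=.
by rewrite leqNgt (valP I).
Qed.

Definition pair_point (z : coords K (big_subset n)) (y : coords K 'I_n) :
    coords K L :=
  [ffun k : L => match k with inl B => z B | inr i => y i end].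

(* Matching the torus parameters with a mixture amounts to
   [p * (1 - p) = t0 * (1 - p *+ 2) ^+ 2], solvable iff [1 + t0 *+ 4 != 0]. *)
Lemma torus_cumulant (t0 : K) (t : 'I_n -> K) (y : coords K 'I_n) :
  (forall i, t i != 0) -> 1 + t0 *+ 4 != 0 ->
  exists p a b, glue (pair_point (monomial_point t0 t) y) = cumulant p a b
    /\ forall i, a i != b i.
Proof.
move=> t_neq0 D0.
(* With [s = 1 - 2 p] one has [s ^+ 2 = 1 - 4 p (1 - p)], so [p (1 - p) = t0 * s ^+ 2] becomes this
   equation; a square root solves it. *)
have [s s0 sD] : exists2 s : K, s != 0 & s ^+ 2 * (1 + t0 *+ 4) = 1.
  exists (sqrtC (1 + t0 *+ 4))^-1; first by rewrite invr_eq0 sqrtC_eq0.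
  by rewrite exprVn sqrtCK mulVf.
pose p := (1 - s) / 2.
have two0 : 2 != 0 :> K by rewrite pnatr_eq0.
have p2 : p *+ 2 = 1 - s by rewrite -[p *+ 2]mulr_natr divfK.
have pq : p * (1 - p) = t0 * s ^+ 2.
  have four0 : 4 != 0 :> K by rewrite pnatr_eq0.
  apply: (mulIf four0).
  have -> : p * (1 - p) * 4 = p *+ 2 * (2 - p *+ 2) by ring.
  rewrite p2.
  have -> : (1 - s) * (2 - (1 - s)) = 1 - s ^+ 2 by ring.
  by rewrite -[1 in LHS]sD; ring.
pose d i := t i / s.
(* The two values with difference [d i] and weighted mean [y i]. *)
exists p, (fun i => y i + (1 - p) * d i), (fun i => y i - p * d i).
have dE i : y i + (1 - p) * d i - (y i - p * d i) = d i :> K by ring.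
split=> [|i]; last first.
  by rewrite -subr_eq0 dE; apply: mulf_neq0 (t_neq0 i) _; rewrite invr_eq0.
apply/ffunP => I; rewrite [RHS]ffunE ffunE; case: insubP => [B I2 BI|].
  rewrite leqNgt I2 /= !ffunE BI pq p2 subKr (eq_bigr _ (fun i _ => dE i)).
  rewrite big_split /= prodr_const -{2}(subnKC I2) exprD !exprVn.
  by move: (expf_neq0 (#|I| - 2) s0) => S0; field; rewrite S0.
rewrite -ltnNge ltnS => I1; rewrite I1 ffunE.
case: pickP => [i /eqP ->|nI]; first by rewrite !ffunE !big_set1; ring.
suff -> : I = finset.set0 by rewrite !big_set0 !mulr1 addrC subrK.
move: I1; rewrite leq_eqVlt ltnS leqn0 => /orP[/cards1P[i Ii]|].
  by have := nI i; rewrite Ii eqxx.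
by rewrite cards_eq0 => /eqP.
Qed.

Lemma secant_line_mixture S (p : K) (a b : 'I_n -> K) (v : coords K T)
    (v0 : v != 0) :
  (0 < n)%N -> (forall i, a i != b i) -> v = relabel S (mixture p a b) ->
  secant_lines (mkproj v0).
Proof.
move=> n0 ab vE.
pose h (d : 'I_n -> K) (i : 'I_n) : coords K 'I_2 :=
  [ffun k : 'I_2 => if k == 0 then d i else 1].
have h0 d i : h d i != 0.
  apply/eqP => /ffunP/(_ 1); rewrite !ffunE /= => /eqP.
  by rewrite oner_eq0.
have hE d (I : T) : segre_vec (h d) I = \prod_(i in I) d i :> K.
  rewrite ffunE [X in _ * X]big1 ?mulr1.
    by apply: eq_bigr => i _; rewrite ffunE eqxx.
  by move=> i _; rewrite ffunE.
pose P d i := mkproj (swap_at_neq0 S (h0 d) i).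
have hP d : hcoords (segre (P d)) (relabel S (segre_vec (h d))).
  by rewrite -segre_swap; apply: segreE => i; apply: mkproj_hcoords.
exists (P a), (P b); split.
  move=> PE; pose i0 := Ordinal n0.
  have vb0 : relabel S (segre_vec (h b)) != 0 by case/andP: (hP b).
  have := hP a; rewrite PE -(mkproj_eq vb0 (hP b)) => /hcoords_mkproj[c _].
  move=> /(congr1 (relabel S)) /ffunP cE.
  have cI (I : T) : \prod_(i in I) a i = c * \prod_(i in I) b i.
    rewrite -!hE; have := cE I; rewrite relabelK => ->.
    by rewrite ffunE [LHS]ffunE [relabel S _ _]ffunE symdiffK.
  (* The empty set fixes the proportionality factor; a singleton then separates the two Segre
     points. *)
  have c1 : c = 1 by have := cI finset.set0; rewrite !big_set0 mulr1.
  have := cI [set i0]%SET; rewrite !big_set1 c1 mul1r => /eqP.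
  by rewrite (negPf (ab i0)).
rewrite -memvE.
have -> : v = p *: relabel S (segre_vec (h a)) +
              (1 - p) *: relabel S (segre_vec (h b)).
  apply/ffunP => I; rewrite vE [LHS]ffunE [LHS]ffunE -!hE [RHS]ffunE.
  by congr (_ + _); rewrite [RHS]ffunE [relabel S _ _]ffunE.
rewrite memv_add // memvZ //; first by case/andP: (hP a).
by case/andP: (hP b).
Qed.

(** Each inclusion uses minimality of a closure: of [Sec] to reduce to points on secant lines, and
    of [T2] to reduce to torus points. *)
Lemma secant_chart_isomorphic (S : T) :
  (0 < n)%N -> isomorphic (Sec K n `&` chart_domain S)%classic N.
Proof.
move=> n0.
have [Phi [Psi [[PhiP PsiP] [PhiK PsiK] PhiPsi1 mixE]]] := cumulant_change K n.
pose f (x : coords K T) := unglue (Phi (relabel S x)).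
pose g (w : coords K L) := relabel S (Psi (glue w)).
have c01 : (#|finset.set0 : T| <= 1)%N by rewrite cards0.
have gS w : g w S = 1.
  by rewrite ffunE symdiffv (PhiPsi1 _ _ c01).2 glue_set0.
have g0 w : g w != 0.
  by apply/eqP => /ffunP/(_ S); rewrite gS ffunE => /eqP; rewrite oner_eq0.
have fP : poly_map (@coordinate K T) f.
  apply: poly_map_comp (@unglue_poly K n) _.
  exact: poly_map_comp PhiP (@relabel_poly K n S).
have gP : poly_map (@coordinate K L) g.
  apply: poly_map_comp (@relabel_poly K n S) _.
  exact: poly_map_comp PsiP (@glue_poly K n).
have fgK : cancel g f by move=> w; rewrite /f /g relabelK PsiK glueK.
have gfK (x : coords K T) : x S = 1 -> g (f x) = x.
  move=> xS; rewrite /f /g unglueK ?PhiK ?relabelK //.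
  by rewrite (PhiPsi1 _ _ c01).1 ffunE symdiff0.
apply: (chart_isomorphic fP gP gS fgK gfK (g0 := g0)) => [P [_]//|w].
split=> [[Secw _]|Nw]; last split.
- have secant_sub : (@secant_lines K n `<=` [set P | forall v : coords K T,
    hcoords P v -> v S = 0 \/ N (f (dehomog S v))])%classic.
    move=> P [a [b [_ Pab]]] v /andP[vP _].
    have /memv_addP[u uA [u' uB ->]] := subvP Pab _ vP.
    case/vlineP: uA => c1 ->; case/vlineP: uB => c2 ->.
    (* As a closed condition on the vector, the claim need only be checked for [a], [b] without zero
       coordinates. *)
    have [F _ FE] := chart_closed S fP product_closed.
    pose Z := [set v | forall p, F p -> peval p v = 0]%classic.
    apply/FE; apply: (secant_vec_closed (Z := Z)); first by exists F.
    move=> a1 b1 a0 b0; set v' := _ + _; apply/FE.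
    have [|vS] := eqVneq (v' S) 0; [by left | right].
    have [p [a' [b' E]]] := segre_mixture a0 b0 vS.
    by rewrite /f E (mixE p a' b').1; exact: unglue_cumulant.
  have := Secw _ (conj (chart_proj_closed S fP product_closed) secant_sub).
  move=> /(_ (g w) (mkproj_hcoords _)); rewrite gS => -[/eqP|].
    by rewrite oner_eq0.
  have -> : dehomog S (g w) = g w by rewrite /dehomog gS invr1 scale1r.
  by rewrite fgK.
- pose z : coords K (big_subset n) := [ffun B => w (inl B)].
  pose y : coords K 'I_n := [ffun i => w (inr i)].
  have wE : w = pair_point z y by apply/ffunP => -[B|i]; rewrite !ffunE.
  have zT : T2 K n z by case: Nw.
  rewrite wE; move: z y zT {wE} => z y zT.
  (* With [y] fixed, the admissible [z] form a closed set, so torus points suffice. *)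
  pose D := [set z | Sec K n (mkproj (g0 (pair_point z y)))]%classic.
  have Dcl : affine_closed D.
    apply: (affine_closed_preimage (h := pair_point^~ y)
      (N := [set w | Sec K n (mkproj (g0 w))]%classic)).
      move=> [B|i].
        by apply: polyfun_ext (polyfun_coord K B) => x; rewrite ffunE.
      by apply: polyfun_ext (polyfun_const _ (y i)) => x; rewrite ffunE.
    exact: mkproj_preimage_closed gP (zclosure_proj_closed _).
  apply: (zT D); split=> // _ [t0 [t [t0_neq0 t_neq0 ->]]].
  (* Varying [t0] alone avoids the one value with [1 + t0 *+ 4 = 0]; [w] is [1 + (t0 + e) *+ 4] as a
     polynomial in [e]. *)
  suff : D (monomial_point (t0 + 0) t) by rewrite addr0.
  apply: (curve_closed (c := fun e => monomial_point (t0 + e) t)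
    (w := 4%:P * 'X + (1 + t0 *+ 4)%:P) Dcl).
  + move=> I; apply: (@polyfun_ext _ _ _ _
      (fun e => (t0 + e) * \prod_(i in val I) t i)) => [e|].
      by rewrite ffunE.
    apply: polyfun_mul; last exact: polyfun_const.
    by apply: polyfun_add; [exact: polyfun_const | exact: polyfun_gen].
  + apply: contraTneq isT => /(congr1 (fun r : {poly K} => r`_1)).
    rewrite coefD coefCM coefX coefC coef0 mulr1 addr0 => /eqP.
    by rewrite pnatr_eq0.
  move=> e; rewrite hornerD hornerM !hornerC hornerX => De.
  have De' : 1 + (t0 + e) *+ 4 != 0.
    by rewrite mulrnDl addrA addrC -[e *+ 4]mulr_natl.
  have [p [a [b [uE ab]]]] := torus_cumulant y t_neq0 De'.
  apply: sub_gen_smallest.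
  apply: (secant_line_mixture (p := p) (S := S) _ n0 ab).
  by rewrite /g uE; have [_ ->] := mixE p a b.
- by apply/(chart_domainP S (mkproj_hcoords (g0 w))); rewrite gS oner_neq0.
Qed.

End SecantVariety.

Theorem theorem4p5 (R : realType) (n : nat) (hn : (2 <= n)%N) :
  isomorphic (SecV R[i] n)
    (affine_prod (T2 R[i] n) (affine_n R[i] n)) /\
  (forall P : proj_space R[i] {set 'I_n}, Sec R[i] n P ->
     exists U : set (proj_space R[i] {set 'I_n}),
       [/\ open_in (Sec R[i] n) U, U P
         & isomorphic U (affine_prod (T2 R[i] n) (affine_n R[i] n))]).
Proof.
have n0 : (0 < n)%N by apply: ltnW.
(* [x_empty_neq0] is by definition the chart domain at the empty set. *)
split; first exact: (@secant_chart_isomorphic _ n finset.set0 n0).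
move=> P SecP; have /andP[_ v0] := hcoords_vpick P.
(* Some homogeneous coordinate of [P] is nonzero, so the charts cover. *)
have [S vS] : exists S, pick_coords P S != 0.
  apply/existsP; apply: contraNT v0 => /existsPn v0.
  by apply/eqP/ffunP => S; rewrite [RHS]ffunE; apply/eqP/negPn.
exists (Sec R[i] n `&` chart_domain S)%classic; split.
- by exists (chart_domain S) => //; exact: chart_domain_open.
- by split => //; apply/(chart_domainP _ (hcoords_vpick P)).
- exact: secant_chart_isomorphic n0.
Qed.
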